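(* Let $\lambda$ be a nonzero real number, let $(a_{n,\lambda})_{n\ge 0}$ be a sequence of real numbers, and let $(a_{n,k}(\lambda))_{n,k\ge 0}$ be its degenerate Euler-Seidel matrix. Then for every integer $n\ge 0$, $$a_{n,0}(\lambda)=\sum_{k=0}^{n}\binom{n}{k}(-1)^{n-k}\langle 1-\lambda\rangle_{n-k,\lambda}\,a_{0,k}(\lambda).$$
   Context: For a nonzero real number $\lambda$ and real $x$, the generalized rising factorials are $\langle x\rangle_{0,\lambda}=1$ and $\langle x\rangle_{n,\lambda}=x(x+\lambda)\cdots(x+(n-1)\lambda)$ for $n\ge 1$. Given a sequence $(a_{n,\lambda})_{n\ge 0}$, its degenerate Euler-Seidel matrix $(a_{n,k}(\lambda))_{n,k\ge 0}$ is defined recursively by $a_{n,0}(\lambda)=a_{n,\lambda}$ for $n\ge 0$, and $a_{n,k}(\lambda)=\big(1-(k-n)\lambda\big)a_{n,k-1}(\lambda)+a_{n+1,k-1}(\lambda)$ for $n\ge 0$, $k\ge 1$. *)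

(* Defs.v *)
From mathcomp Require Import all_boot all_order all_algebra reals.

Set Implicit Arguments.
Unset Strict Implicit.
Unset Printing Implicit Defensive.

Import GRing.Theory.
Local Open Scope ring_scope.

(* <x>_{n,lambda} = x (x + lambda) ... (x + (n - 1) lambda), with value 1 at n = 0 *)
Definition rising_fact (R : realType) (lambda x : R) (n : nat) : R :=
  \prod_(i < n) (x + i%:R * lambda).

(* [euler_seidel lambda a n k] is the entry a_{n,k}(lambda); the recursion is on
   the second index. The difference k - n is taken in R, as it may be negative. *)
Fixpoint euler_seidel (R : realType) (lambda : R) (a : nat -> R) (n k : nat)
    {struct k} : R :=
  match k with
  | 0 => a n
  | k'.+1 => (1 - (k%:R - n%:R) * lambda) * euler_seidel lambda a n k'
             + euler_seidel lambda a n.+1 k'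
  end.

(* Main.v *)
Require Import Defs.
From mathcomp Require Import all_boot all_order all_algebra reals.
From mathcomp Require Import ring.

(** The recursion, read backwards, expresses row [n.+1] of the matrix through
    row [n]:
      [a_{n+1,k} = a_{n,k+1} - (1 - (k+1-n) lambda) a_{n,k}].
    As this also shifts the column, the induction on [n] has to treat all
    columns at once: with [x_k = 1 - (k+1) lambda],
      [a_{n,k} = \sum_(j <= n) C(n, j) (-1)^(n-j) <x_k>_{n-j} a_{0,k+j}]
    (lemma [euler_seidel_inversion]), and the theorem is the column [k = 0].
    Since [x_{k+1} = x_k - lambda], comparing the coefficients of [a_{0,k+j}] in
    the induction step and cancelling the common factor [<x_k>_{n-j}] leaves
      [C(n, j-1) (x_k - lambda) + C(n, j) (x_k + n lambda)
         = C(n+1, j) (x_k + (n-j) lambda)],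
    which follows from Pascal's rule and [j C(n, j) = (n-j+1) C(n, j-1)]. *)

Import GRing.Theory.
Local Open Scope ring_scope.

Lemma rising_fact0 (R : realType) (lambda x : R) : rising_fact lambda x 0 = 1.
Proof. exact: big_ord0. Qed.

Lemma rising_factS (R : realType) (lambda x : R) (n : nat) :
  rising_fact lambda x n.+1 = rising_fact lambda x n * (x + n%:R * lambda).
Proof. exact: big_ord_recr. Qed.

Lemma rising_factSl (R : realType) (lambda x : R) (n : nat) :
  rising_fact lambda x n.+1 = x * rising_fact lambda (x + lambda) n.
Proof.
rewrite /rising_fact big_ord_recl mul0r addr0; congr (_ * _).
by apply: eq_bigr => i _; rewrite lift0 -natr1; ring.
Qed.

Lemma euler_seidel_row_succ (R : realType) (lambda : R) (a : nat -> R)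
    (n k : nat) :
  euler_seidel lambda a n.+1 k =
    euler_seidel lambda a n k.+1
    - (1 - (k.+1%:R - n%:R) * lambda) * euler_seidel lambda a n k.
Proof. by rewrite [euler_seidel lambda a n k.+1]/=; ring. Qed.

(** The coefficient of [a_{0,k+i+1}] in the induction step, where
    [x = 1 - (k+1) lambda]. *)
Lemma rising_fact_bin_pascal (R : realType) (lambda x : R) (n i : nat) :
  (i <= n)%N ->
  'C(n.+1, i.+1)%:R * (-1) ^+ (n - i) * rising_fact lambda x (n - i) =
  'C(n, i)%:R * (-1) ^+ (n - i) * rising_fact lambda (x - lambda) (n - i)
  - (x + n%:R * lambda)
    * ('C(n, i.+1)%:R * (-1) ^+ (n - i.+1) * rising_fact lambda x (n - i.+1)).
Proof.
rewrite leq_eqVlt => /predU1P[-> | lt_in].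
  by rewrite subnn !rising_fact0 !binn bin_small //; ring.
have [p def_n] : exists p, n = (i.+1 + p)%N.
  by exists (n - i.+1)%N; rewrite subnKC.
have -> : (n - i = p.+1)%N by rewrite def_n addSnnS addKn.
have -> : (n - i.+1 = p)%N by rewrite def_n addKn.
rewrite [rising_fact _ (x - _) _]rising_factSl subrK rising_factS.
rewrite binS natrD exprS.
have bin_absorb : i.+1%:R * 'C(n, i.+1)%:R = p.+1%:R * 'C(n, i)%:R :> R.
  by rewrite -!natrM mul_bin_left def_n addSnnS addKn.
have -> : n%:R = i.+1%:R + p%:R :> R by rewrite def_n natrD.
rewrite -[p.+1%:R]natr1 in bin_absorb.
(* The difference of the two sides is a multiple of [bin_absorb]. *)
apply/eqP; rewrite -subr_eq0; apply/eqP.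
transitivity ((-1) ^+ p * rising_fact lambda x p * lambda
  * (i.+1%:R * 'C(n, i.+1)%:R - (p%:R + 1) * 'C(n, i)%:R)); first by ring.
by rewrite bin_absorb subrr mulr0.
Qed.

(** Every entry of the matrix in terms of its row of index [0]. *)
Lemma euler_seidel_inversion (R : realType) (lambda : R) (a : nat -> R)
    (n k : nat) :
  euler_seidel lambda a n k =
    \sum_(j < n.+1)
      'C(n, j)%:R * (-1) ^+ (n - j)
      * rising_fact lambda (1 - k.+1%:R * lambda) (n - j)
      * euler_seidel lambda a 0 (k + j).
Proof.
elim: n k => [|n IHn] k.
  by rewrite big_ord1 rising_fact0 bin0 addn0 expr0 !mul1r.
rewrite euler_seidel_row_succ !IHn.
set x := 1 - k.+1%:R * lambda.
have -> : 1 - k.+2%:R * lambda = x - lambda by rewrite /x -[k.+2%:R]natr1; ring.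
have -> : 1 - (k.+1%:R - n%:R) * lambda = x + n%:R * lambda by rewrite /x; ring.
(* Append to the second sum its term of index [n.+1], which is zero, so that
   both it and the goal split into the term of index [0] and [n.+1] others. *)
have -> : \sum_(j < n.+1) 'C(n, j)%:R * (-1) ^+ (n - j)
      * rising_fact lambda x (n - j) * euler_seidel lambda a 0 (k + j)
    = \sum_(j < n.+2) 'C(n, j)%:R * (-1) ^+ (n - j)
      * rising_fact lambda x (n - j) * euler_seidel lambda a 0 (k + j).
  by rewrite [RHS]big_ord_recr /= bin_small // !mul0r addr0.
rewrite [X in _ * X]big_ord_recl [RHS]big_ord_recl !bin0 !subn0 !addn0.
rewrite mulrDr opprD addrCA; congr (_ + _).
  by rewrite rising_factS exprS; ring.
rewrite mulr_sumr -sumrB; apply: eq_bigr => i _.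
rewrite lift0 subSS (rising_fact_bin_pascal _ _ _ _ _ (leq_ord i)) addSnnS.
by ring.
Qed.

Theorem theorem2p3 (R : realType) (lambda : R) (hlambda : lambda != 0)
    (a : nat -> R) (n : nat) :
  euler_seidel lambda a n 0 =
    \sum_(0 <= k < n.+1)
      'C(n, k)%:R * (-1) ^+ (n - k) * rising_fact lambda (1 - lambda) (n - k)
      * euler_seidel lambda a 0 k.
Proof. by rewrite big_mkord euler_seidel_inversion mul1r. Qed.
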